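(* Let $G$ be an $n\times n$ bipartite graph with $n\ge2$. If $\delta(G)\ge 2\widetilde{\alpha}(G)+1$, then $G$ is Hamiltonian.
   Context: An $n\times n$ bipartite graph has a bipartition $(V_1,V_2)$ with $|V_1|=|V_2|=n$. $\delta(G)$ is the minimum degree. For a bipartite graph $G$ with bipartition $(V_1,V_2)$, $\widetilde{\alpha}(G)$ is the maximum integer $k$ such that there exist $k$-sets $S_1\subseteq V_1$, $S_2\subseteq V_2$ with no edges between $S_1$ and $S_2$. *)

(* Defs.v *)
From mathcomp Require Import all_boot.

Set Implicit Arguments.
Unset Strict Implicit.
Unset Printing Implicit Defensive.

Definition simple_graph (T : finType) (e : rel T) : Prop :=
  symmetric e /\ irreflexive e.

Definition bipartition (T : finType) (e : rel T) (V1 V2 : {set T}) : Prop :=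
  [/\ V1 :|: V2 = [set: T], [disjoint V1 & V2] &
      forall x y, e x y -> (x \in V1) != (y \in V1)].

Definition balanced_bipartite (n : nat) (T : finType) (e : rel T)
    (V1 V2 : {set T}) : Prop :=
  [/\ simple_graph e, bipartition e V1 V2, #|V1| = n & #|V2| = n].

Definition degree (T : finType) (e : rel T) (x : T) : nat :=
  #|[set y | e x y]|.

(* Every degree is at most #|T|, so the default value #|T| plays no role when
   T is nonempty. *)
Definition min_degree (T : finType) (e : rel T) : nat :=
  \big[minn/#|T|]_(x : T) degree e x.

Definition has_bihole (T : finType) (e : rel T) (V1 V2 : {set T})
    (k : nat) : bool :=
  [exists S1 : {set T}, exists S2 : {set T},
    [&& S1 \subset V1, S2 \subset V2, #|S1| == k, #|S2| == k &
        [forall x in S1, forall y in S2, ~~ e x y]]].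

(* The maximum is over a nonempty set, as k = 0 always qualifies; and any k
   that qualifies is at most #|V1|. *)
Definition bipartite_indep_number (T : finType) (e : rel T)
    (V1 V2 : {set T}) : nat :=
  \max_(k < #|V1|.+1 | has_bihole e V1 V2 k) k.

(* ucycle accepts the sequences [::] and [:: x; y], which are not cycles of a
   simple graph; hence the bound on the length. *)
Definition hamiltonian (T : finType) (e : rel T) : Prop :=
  exists c : seq T, [/\ 2 < size c, ucycle e c & forall x : T, x \in c].

(* Main.v *)
Require Import Defs.
From mathcomp Require Import all_boot.
From mathcomp Require Import zify.

(* Adding edges preserves the hypotheses and the complete bipartite graph is
   Hamiltonian, so it suffices to treat a graph with a Hamilton path
   x_1 y_1 ... x_n y_n, x_1 and y_n being non-adjacent. Suppose there is no
   Hamilton cycle and let I = {i | x_1 ~ y_i}, J = {j | x_j ~ y_n}. By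
   Ore's crossing argument I and J are disjoint. The chords x_1 y_i and x_j y_n
   close up to a Hamilton cycle together with x_i y_j if i < j, and together
   with x_(i+1) y_(j-1) if j < i, so these pairs are not edges. As |I| and |J|
   are at least 2a + 1, where a is the bipartite hole number, some m has a + 1
   elements of I on either side of it (m counting for both sides); whichever
   side of m contains a + 1 elements of J, one of the two families of non-edges
   yields a hole of size a + 1. *)

Set Implicit Arguments.
Unset Strict Implicit.
Unset Printing Implicit Defensive.

(** * Bipartite holes and the minimum degree *)

Lemma subset_of_card (T : finType) (S : {set T}) (k : nat) :
  k <= #|S| -> exists2 S' : {set T}, S' \subset S & #|S'| = k.
Proof.
move=> lekS; exists [set x in take k (enum S)].
  by apply/subsetP=> x; rewrite inE => /mem_take; rewrite mem_enum.
rewrite cardsE (card_uniqP _) ?take_uniq ?enum_uniq //.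
by rewrite size_take_min -cardE; apply/minn_idPl.
Qed.

(** Trimming the larger side to the size of the smaller one leaves a balanced hole. *)
Lemma card_bihole_le (T : finType) (e : rel T) (V1 V2 S1 S2 : {set T}) :
  S1 \subset V1 -> S2 \subset V2 ->
  (forall x y, x \in S1 -> y \in S2 -> ~~ e x y) ->
  minn #|S1| #|S2| <= bipartite_indep_number e V1 V2.
Proof.
move=> sS1 sS2 hole; set k := minn _ _.
have [S1' sS1' cS1] := subset_of_card (geq_minl #|S1| #|S2|).
have [S2' sS2' cS2] := subset_of_card (geq_minr #|S1| #|S2|).
have ltkV : k < #|V1|.+1.
  by rewrite ltnS (leq_trans (geq_minl _ _)) // subset_leq_card.
apply: (@leq_bigmax_cond _ _ (fun i : 'I_(#|V1|.+1) => i : nat)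
  (Ordinal ltkV)).
apply/existsP; exists S1'; apply/existsP; exists S2'.
rewrite (subset_trans sS1') // (subset_trans sS2') // cS1 cS2 !eqxx /=.
apply/forall_inP=> x xS; apply/forall_inP=> y yS.
by apply: hole; [apply: (subsetP sS1') | apply: (subsetP sS2')].
Qed.

Lemma min_degree_le (T : finType) (e : rel T) (x : T) :
  min_degree e <= degree e x.
Proof.
rewrite /min_degree; elim: (index_enum T) (mem_index_enum x) => //= y s IHs.
rewrite inE big_cons geq_min => /orP[/eqP<- | /IHs ->]; last exact: orbT.
by rewrite leqnn.
Qed.

(** * Closing a path to a cycle with two or three chords *)

Section Crossings.

Variables (T : eqType) (e : rel T).
Hypothesis e_sym : symmetric e.

Lemma path_rev_sym x p : path e x p -> path e (last x p) (rev (belast x p)).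
Proof. by rewrite rev_path (eq_path (e' := e)). Qed.

Lemma rev_cons_belast (x : T) p : rev (x :: p) = last x p :: rev (belast x p).
Proof. by rewrite lastI rev_rcons. Qed.

Lemma last_rev_belast (x : T) p y : last y (rev (x :: p)) = x.
Proof. by rewrite rev_cons last_rcons. Qed.

(** Ore's crossing: run from [x] through [A], jump to the far end of the path, return along [B] to
    [b], and take the chord back to [x]. *)
Lemma crossing_cycle1 x A b B :
    path e x (A ++ b :: B) -> e (last x A) (last b B) -> e x b ->
  cycle e (x :: A ++ rev (b :: B)).
Proof.
rewrite cat_path /= => /and3P[pA _ pB] eAB exb.
rewrite rcons_cat cat_path pA -cats1 cat_path last_rev_belast.
by rewrite rev_cons_belast /= eAB path_rev_sym //= e_sym exb.
Qed.

(** Only the middle segment keeps its direction: [A] back to [x], chord to [b], along [B], chord to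
    the end of [C], back to [c], chord to the end of [A]. *)
Lemma crossing_cycle2 x A b B c C :
    path e x (A ++ b :: B ++ c :: C) ->
    e x b -> e (last b B) (last c C) -> e (last x A) c ->
  cycle e (rev (x :: A) ++ (b :: B) ++ rev (c :: C)).
Proof.
rewrite cat_path /= cat_path /= => /and5P[pA _ pB _ pC] exb eBC eAc.
rewrite {1}rev_cons_belast /= -cats1 -!catA /= cat_path path_rev_sym //=.
have ->: last (last x A) (rev (belast x A)) = x.
  by have := last_rev_belast x A x; rewrite rev_cons_belast.
rewrite exb -catA cat_path pB cat_path last_rev_belast.
by rewrite rev_cons_belast /= eBC path_rev_sym //= e_sym eAc.
Qed.

(** All three segments keep their direction and are traversed in the opposite order, so each chord
    joins the end of one segment to the start of another. *)
Lemma crossing_cycle3 x A b B c C :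
    path e x (A ++ b :: B ++ c :: C) ->
    e x (last b B) -> e b (last c C) -> e (last x A) c ->
  cycle e ((c :: C) ++ (b :: B) ++ (x :: A)).
Proof.
rewrite cat_path /= cat_path /= => /and5P[pA _ pB _ pC] exB ebC eAc.
rewrite -cats1 -!catA /= cat_path pC /= (e_sym _ b) ebC.
by rewrite -catA cat_path pB /= (e_sym _ x) exB cat_path pA /= eAc.
Qed.

End Crossings.

(** * Cutting a path at given positions *)

Lemma split_cons_at (T : eqType) (d x : T) (s : seq T) (p : nat) :
  0 < p <= size s ->
  exists A b B, [/\ s = A ++ b :: B, size A = p.-1,
    last x A = nth d (x :: s) p.-1 & b = nth d (x :: s) p].
Proof.
case: p => // p /= lps; exists (take p s), (nth d s p), (drop p.+1 s).
rewrite -drop_nth // cat_take_drop size_takel 1?ltnW //; split => //.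
have szp : size (take p s) = p by rewrite size_takel // ltnW.
by rewrite (last_nth d) szp -[x :: take p s]/(take p.+1 (x :: s)) nth_take.
Qed.

(** Positions count from [x] at 0, and the cuts fall just before [p] and [q]. Naming the segment
    ends by [v] lets the chords of the crossing lemmas be given by indices. *)
Lemma split_cons_at2 (T : eqType) (x : T) (s : seq T) (p q : nat) :
  0 < p < q -> q <= size s ->
  let v := nth x (x :: s) in
  exists A b B c C, s = A ++ b :: B ++ c :: C /\
    [/\ last x A = v p.-1, b = v p, last b B = v q.-1, c = v q &
        last c C = v (size s)].
Proof.
move=> /andP[p0 ltpq] leqs v.
have [|A [b [D [sE szA lA bE]]]] := @split_cons_at T x x s p; first lia.
have szs : size s = p + size D by rewrite sE size_cat /= szA; lia.
have vD i : nth x (b :: D) i = v (p + i).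
  rewrite /v sE -cat_cons nth_cat /= szA prednK // ltnNge leq_addr /=.
  by rewrite addKn.
have [|B [c [C [DE szB lB cE]]]] := @split_cons_at T x b D (q - p); first lia.
exists A, b, B, c, C; split; first by rewrite sE DE.
split=> //.
- by rewrite lB vD; congr v; lia.
- by rewrite cE vD; congr v; lia.
- have -> : last c C = last x s by rewrite sE DE last_cat /= last_cat.
  by rewrite (last_nth x).
Qed.

Lemma hamiltonian_perm (T : finType) (e : rel T) (s c : seq T) :
  uniq s -> (forall x, x \in s) -> 2 < size s -> perm_eq c s -> cycle e c ->
  hamiltonian e.
Proof.
move=> us sT szs cs cyc; exists c; rewrite /ucycle cyc (perm_uniq cs) us.
by rewrite (perm_size cs); split=> // x; rewrite (perm_mem cs).
Qed.

(** Take the least [m] with more than [a] elements up to it. By minimality at most [a] elements lie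
    strictly below [m], so all the others are at least [m]. *)
Lemma card_initial_threshold n (I : {set 'I_n}) (a : nat) : a < #|I| ->
  exists m : nat, a < #|[set i in I | i <= m]| /\
                  #|I| - a <= #|[set i in I | m <= i]|.
Proof.
move=> ltaI; pose f m := #|[set i in I | i <= m]|.
have exm : exists m, a < f m.
  exists n; rewrite /f (_ : [set _ in _ | _] = I) //.
  by apply/setP=> i; rewrite inE ltnW ?andbT.
case: (ex_minnP exm) => m ltafm minm; exists m; split=> //.
have : #|[set i in I | i < m]| <= a.
  case: m ltafm minm => [|m] ltafm minm.
    by rewrite (_ : [set _ in _ | _] = set0) ?cards0 //; apply/setP=> i;
       rewrite !inE andbF.
  by rewrite leqNgt; apply/negP=> /minm; rewrite ltnn.
have := cardsID [set i : 'I_n | i < m] I.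
have -> : I :&: [set i : 'I_n | i < m] = [set i in I | i < m].
  by apply/setP=> i; rewrite !inE.
have -> : I :\: [set i : 'I_n | i < m] = [set i in I | m <= i].
  by apply/setP=> i; rewrite !inE -leqNgt andbC.
by move=> <- lea; rewrite leq_subLR leq_add2r.
Qed.

(** * From a Hamilton path to a Hamilton cycle, edge addition, and the complete case *)

Section PathToCycle.

Variables (n a : nat) (T : finType) (e : rel T) (V1 V2 : {set T}).
Hypothesis n_ge2 : 2 <= n.
Hypothesis G_bip : balanced_bipartite n e V1 V2.
Hypothesis no_hole : forall S1 S2 : {set T}, S1 \subset V1 -> S2 \subset V2 ->
  a < #|S1| -> a < #|S2| -> exists x y, [/\ x \in S1, y \in S2 & e x y].
Hypothesis deg_gt : forall x, 2 * a < degree e x.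

Let e_sym : symmetric e. Proof. by case: G_bip => [[]]. Qed.

Lemma in_V2 x : (x \in V2) = (x \notin V1).
Proof.
case: G_bip => _ [VT dV _] _ _; have := in_setT x; rewrite -VT inE.
have := disjointFr dV (x := x); case: (x \in V1) => //= [-> //|_ ->//].
Qed.

Lemma edge_side x y : e x y -> (y \in V1) = (x \notin V1).
Proof.
by case: G_bip => _ [_ _ H] _ _ /H; case: (x \in V1); case: (y \in V1).
Qed.

Lemma card_vertices : #|T| = 2 * n.
Proof.
case: G_bip => _ [VT dV _] c1 c2.
rewrite -cardsT -VT cardsU (_ : V1 :&: V2 = set0) ?cards0 ?c1 ?c2; first lia.
by apply/eqP; rewrite setI_eq0.
Qed.

Lemma hamiltonian_of_path (x : T) (p : seq T) :
  x \in V1 -> last x p \in V2 -> path e x p -> uniq (x :: p) ->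
  (forall y, y \in x :: p) -> hamiltonian e.
Proof.
move=> xV1 lV2 pp up pT.
have szp : size p = (2 * n).-1.
  have := card_uniqP up; rewrite (eq_card (B := T)) ?card_vertices /=; first lia.
  by move=> z; rewrite pT.
pose v := nth x (x :: p).
have lastv : last x p = v (2 * n).-1 by rewrite (last_nth x) szp.
have v_side k : k < 2 * n -> (v k \in V1) = ~~ odd k.
  elim: k => [|k IHk] ltk; first by rewrite xV1.
  rewrite (@edge_side (v k)) ?IHk; try lia.
  by move/(pathP x): pp; apply; lia.
have v_inj k l : k < 2 * n -> l < 2 * n -> v k = v l -> k = l.
  by move=> lk ll /eqP; rewrite nth_uniq //= ?szp => [/eqP||]; lia.
have v_surj z : exists2 k, k < 2 * n & z = v k.
  exists (index z (x :: p)); last by rewrite /v nth_index.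
  by have := index_mem z (x :: p); rewrite pT /= szp; lia.
have ham c : perm_eq c (x :: p) -> cycle e c -> hamiltonian e.
  by apply: hamiltonian_perm => //=; rewrite szp; lia.
case exy : (e x (last x p)).
  apply: (ham (x :: p)) => //=.
  by rewrite rcons_path pp e_sym.
(* The path alternates sides, so even positions carry the x's and odd ones the y's, both numbered
   from 0. *)
pose X (i : 'I_n) := v (2 * i); pose Y (i : 'I_n) := v (2 * i).+1.
have XV1 i : X i \in V1 by rewrite v_side; have := ltn_ord i; lia.
have YV2 i : Y i \in V2 by rewrite in_V2 v_side; have := ltn_ord i; lia.
pose I := [set i : 'I_n | e x (Y i)].
pose J := [set j : 'I_n | e (last x p) (X j)].
(* Every neighbour of [x] lies in [V2], hence is some [Y i] with [i] in [I]. *)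
have cardI : 2 * a < #|I|.
  apply: leq_trans (deg_gt x) _; apply: leq_trans (leq_imset_card Y I).
  apply/subset_leq_card/subsetP=> z; rewrite inE => exz.
  have [k ltk zE] := v_surj z.
  have := edge_side exz; rewrite xV1 zE v_side //= => /negbFE oddk.
  have ltkn : k./2 < n by lia.
  have YE : Y (Ordinal ltkn) = z by rewrite zE /Y; congr v; rewrite /=; lia.
  by apply/imsetP; exists (Ordinal ltkn); rewrite ?inE YE.
have cardJ : 2 * a < #|J|.
  apply: leq_trans (deg_gt (last x p)) _.
  apply: leq_trans (leq_imset_card X J).
  apply/subset_leq_card/subsetP=> z; rewrite inE => exz.
  have [k ltk zE] := v_surj z.
  have := edge_side exz; rewrite -in_V2 lV2 zE v_side //= => evk.
  have ltkn : k./2 < n by lia.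
  have XE : X (Ordinal ltkn) = z by rewrite zE /X; congr v; rewrite /=; lia.
  by apply/imsetP; exists (Ordinal ltkn); rewrite ?inE XE.
have permABC (A B C : seq T) b c : p = A ++ b :: B ++ c :: C ->
    perm_eq ((c :: C) ++ (b :: B) ++ (x :: A)) (x :: p).
  move=> ->; rewrite -[x :: A ++ _]/((x :: A) ++ (b :: B) ++ (c :: C)).
  by rewrite perm_catC -catA perm_catCA.
(* Equal indices give Ore's crossing, cut after [X i]; for i < j the cuts come after [X i] and
   [X j]. *)
have [[i j] /= /and3P[iI jJ eij]|no12] := pickP (fun ij : 'I_n * 'I_n =>
  [&& ij.1 \in I, ij.2 \in J & (ij.1 == ij.2) ||
      (ij.1 < ij.2) && e (X ij.1) (Y ij.2)]).
  move: iI jJ; rewrite !inE => eI eJ.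
  case/orP: eij => [/eqP ij | /andP[ltij eXY]].
    subst j; have [|A [b [B [pE _ lA bE]]]] :=
      @split_cons_at T x x p (2 * i).+1; first by rewrite szp; have := ltn_ord i; lia.
    apply: (ham (x :: A ++ rev (b :: B))).
      by rewrite pE perm_cons perm_cat2l perm_rev.
    apply: crossing_cycle1 => //; first by rewrite -pE.
      rewrite lA e_sym; move: eJ; rewrite pE last_cat /=.
      by rewrite -pE.
    by rewrite bE.
  have ltj := ltn_ord j.
  have [||A [b [B [c [C [pE [lA bE lB cE lC]]]]]]] :=
    @split_cons_at2 T x p (2 * i).+1 (2 * j).+1; rewrite ?szp; try lia.
  apply: (ham (rev (x :: A) ++ (b :: B) ++ rev (c :: C))).
    rewrite pE -[x :: A ++ _]/((x :: A) ++ (b :: B) ++ (c :: C)).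
    by rewrite perm_cat ?perm_rev // perm_cat2l perm_rev.
  apply: crossing_cycle2 => //; first by rewrite -pE.
  - by rewrite bE.
  - by rewrite lB lC szp e_sym; move: eJ; rewrite lastv.
  - by rewrite lA cE.
(* The ends are non-adjacent, so [J] misses the first index and [I] the last. This keeps the
   positions 2j - 1 and 2i + 2 inside the path. *)
have J_gt0 (j : 'I_n) : j \in J -> 0 < j.
  rewrite inE lt0n; apply: contraTneq => j0.
  by rewrite /X j0 muln0 e_sym /= exy.
have I_ltn (i : 'I_n) : i \in I -> i.+1 < n.
  rewrite inE => eI; have := ltn_ord i; rewrite leq_eqVlt => /orP[/eqP iE|//].
  by move: eI; rewrite /Y -[(2 * i).+1]/((2 * i).+2.-1) (_ : (2 * i).+2 = 2 * n)
    -?lastv ?exy //; lia.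
(* These two positions carry [X] at i + 1 and [Y] at j - 1; the cuts come before [X j] and after
   [Y i]. *)
have [[i j] /= /and4P[iI jJ ltji eij]|no3] := pickP (fun ij : 'I_n * 'I_n =>
  [&& ij.1 \in I, ij.2 \in J, ij.2 < ij.1 &
      e (v (2 * ij.1).+2) (v (2 * ij.2).-1)]).
  have j0 := J_gt0 _ jJ; have ltin := I_ltn _ iI.
  move: iI jJ; rewrite !inE => eI eJ.
  have [||A [b [B [c [C [pE [lA bE lB cE lC]]]]]]] :=
    @split_cons_at2 T x p (2 * j) (2 * i).+2; rewrite ?szp; try lia.
  apply: (ham ((c :: C) ++ (b :: B) ++ (x :: A))); first exact: permABC.
  apply: crossing_cycle3 => //; first by rewrite -pE.
  - by rewrite lB.
  - by rewrite bE lC e_sym szp; move: eJ; rewrite lastv.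
  - by rewrite lA cE e_sym.
have [|m [I1 I2]] := @card_initial_threshold n I a.
  by apply: leq_ltn_trans cardI; rewrite leq_pmull.
have {}I2 : a < #|[set i in I | m <= i]|.
  by apply: leq_trans I2; rewrite ltn_subRL addnn -mul2n.
have [Jhi|Jlo] := ltnP a #|[set j in J | m < j]|.
  have [||||_ [_ [/imsetP[i + ->] /imsetP[j + ->] eXY]]] :=
    @no_hole [set X i | i in [set i in I | i <= m]]
             [set Y j | j in [set j in J | m < j]].
  - by apply/subsetP=> _ /imsetP[i _ ->].
  - by apply/subsetP=> _ /imsetP[i _ ->].
  - rewrite card_in_imset // => i j _ _ /v_inj ij; apply: val_inj => /=.
    by have := ltn_ord i; have := ltn_ord j; lia.
  - rewrite card_in_imset // => i j _ _ /v_inj ij; apply: val_inj => /=.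
    by have := ltn_ord i; have := ltn_ord j; lia.
  move=> /setIdP[iI im] /setIdP[jJ mj].
  by have := no12 (i, j); rewrite /= iI jJ eXY (leq_ltn_trans im mj) orbT.
(* At most [a] of the more than 2a elements of [J] lie above [m]. *)
have {}Jlo : a < #|[set j in J | j <= m]|.
  rewrite -(ltn_add2l a) addnn -mul2n; apply: leq_trans cardJ _.
  rewrite -(cardsID [set j : 'I_n | m < j] J) leq_add //.
    by rewrite (leq_trans _ Jlo) // subset_leq_card //;
       apply/subsetP=> j; rewrite !inE.
  by rewrite subset_leq_card //; apply/subsetP=> j; rewrite !inE -leqNgt andbC.
have [||||_ [_ [/imsetP[i + ->] /imsetP[j + ->] eXY]]] :=
  @no_hole [set v (2 * i).+2 | i : 'I_n in [set i in I | m <= i]]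
           [set v (2 * j).-1 | j : 'I_n in [set j in J | j <= m]].
- apply/subsetP=> _ /imsetP[i /setIdP[/I_ltn iI _] ->].
  by rewrite v_side; lia.
- apply/subsetP=> _ /imsetP[j /setIdP[/J_gt0 jI _] ->].
  by rewrite in_V2 v_side; have := ltn_ord j; lia.
- rewrite card_in_imset // => i j.
  move=> /setIdP[/I_ltn iI _] /setIdP[/I_ltn jI _] /v_inj ij.
  by apply: val_inj => /=; lia.
- rewrite card_in_imset // => i j.
  move=> /setIdP[/J_gt0 iI _] /setIdP[/J_gt0 jI _] /v_inj ij.
  by apply: val_inj => /=; have := ltn_ord i; have := ltn_ord j; lia.
(* Here j <= m <= i: the case j = i was excluded by Ore's crossing, and j < i by [no3]. *)
move=> /setIdP[iI im] /setIdP[jJ jm].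
have := no3 (i, j); have := no12 (i, j); rewrite /= iI jJ eXY /= andbT.
have := leq_trans jm im; rewrite leq_eqVlt => /orP[/eqP/val_inj->|->//].
by rewrite eqxx.
Qed.

(** A cycle using the new edge becomes, on its removal, a Hamilton path of [e] from [x] to [y],
    which [hamiltonian_of_path] closes. *)
Lemma hamiltonian_of_add_edge (x y : T) : x \in V1 -> y \in V2 ->
  hamiltonian [rel u v | [|| e u v, (u == x) && (v == y) |
                             (u == y) && (v == x)]] -> hamiltonian e.
Proof.
move=> xV1 yV2 [c [szc /andP[cyc uc] cT]].
have neq_xy : x != y by apply: contraTneq yV2 => <-; rewrite in_V2 xV1.
have [k p cE] := rot_to (cT x).
have up : uniq (x :: p) by rewrite -cE rot_uniq.
have pT z : z \in x :: p by rewrite -cE mem_rot.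
have szp : 1 < size p by have := congr1 size cE; rewrite size_rot /=; lia.
move: cyc; rewrite -(rot_cycle k) cE /= rcons_path => /andP[pe' le'].
(* With the cycle rotated to start at [x], only its first and closing edges can be new. *)
have e'_notx u v : u != x -> v != x ->
    [|| e u v, (u == x) && (v == y) | (u == y) && (v == x)] -> e u v.
  by move=> /negPf-> /negPf->; rewrite andbF !orbF.
case: p => [|b q] // in up pT szp pe' le' {cE}.
have /and3P[x_bq b_q uq] := up.
have nx z : z \in b :: q -> z != x by apply: contraTneq => ->.
have nxb := nx b (mem_head _ _); have nxl := nx _ (mem_last b q).
have pq : path e b q.
  case/andP: pe' => _; apply: sub_in_path (allss (b :: q)) => u v uq' vq'.
  by apply: e'_notx; apply: nx.
move: pe' le' => /= /andP[exb _] elx.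
have {}exb : e x b \/ b = y.
  by case/or3P: exb => [|/andP[_ /eqP]|/andP[_ /eqP bx]]; [left|right|];
     rewrite // bx eqxx in nxb.
have {}elx : e (last b q) x \/ last b q = y.
  by case/or3P: elx => [|/andP[/eqP lx]|/andP[/eqP]]; [left| |right];
     rewrite // lx eqxx in nxl.
case: exb => [exb|b_y].
  case: elx => [elx|l_y]; last first.
    by apply: (@hamiltonian_of_path x (b :: q)) => //=; rewrite ?l_y ?exb.
  apply: (hamiltonian_perm up pT _ (perm_refl _)) => //=.
  by rewrite exb rcons_path pq elx.
(* If both cycle neighbours of [x] were [y], the cycle would have length two. *)
have elx' : e (last b q) x.
  case: elx => // l_y; case: q {pq uq x_bq nx pT nxl up} b_q szp l_y => // d q.
  by rewrite b_y => b_q _ /= l_y; rewrite -{1}l_y mem_last in b_q.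
have revE : rev (b :: q) = last b q :: rev (belast b q).
  exact: rev_cons_belast.
have perm_rev_xp : perm_eq (x :: rev (b :: q)) (x :: b :: q).
  by rewrite perm_cons perm_rev.
apply: (@hamiltonian_of_path x (rev (b :: q))) => //.
- by rewrite last_rev_belast b_y.
- by rewrite revE /= e_sym elx' path_rev_sym.
- by rewrite (perm_uniq perm_rev_xp).
- by move=> z; rewrite (perm_mem perm_rev_xp).
Qed.

Lemma hamiltonian_complete :
  (forall x y, x \in V1 -> y \in V2 -> e x y) -> hamiltonian e.
Proof.
move=> complete; have [_ _ c1 c2] := G_bip.
pose alt (s t : seq T) := flatten [seq [:: u.1; u.2] | u <- zip s t].
have alt_perm s : forall t, size s = size t -> perm_eq (alt s t) (s ++ t).
  elim: s => [|b s IHs] [|d t] //= [st]; rewrite perm_cons.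
  by rewrite perm_sym perm_catC /= perm_cons perm_catC perm_sym IHs.
have alt_path s : forall t y, size s = size t -> {subset s <= V1} ->
    {subset t <= V2} -> y \in V2 ->
    path e y (alt s t) && (last y (alt s t) \in V2).
  elim: s => [|b s IHs] [|d t] //= y [st] sV1 tV2 yV2.
  have bV1 : b \in V1 by apply: sV1 (mem_head _ _).
  have dV2 : d \in V2 by apply: tV2 (mem_head _ _).
  rewrite e_sym !complete //=; apply: IHs => // z zs.
    by apply: sV1; rewrite inE zs orbT.
  by apply: tV2; rewrite inE zs orbT.
have st : size (enum V1) = size (enum V2) by rewrite -!cardE c1 c2.
have sV1 : {subset enum V1 <= V1} by move=> z; rewrite mem_enum.
have sV2 : {subset enum V2 <= V2} by move=> z; rewrite mem_enum.
have c_perm := alt_perm _ _ st.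
have uV : uniq (enum V1 ++ enum V2).
  rewrite cat_uniq !enum_uniq andbT /=; apply/hasPn=> z.
  by rewrite !mem_enum in_V2.
apply: (hamiltonian_perm uV) c_perm _.
- by move=> z; rewrite mem_cat !mem_enum in_V2; case: (z \in V1).
- by rewrite size_cat -!cardE c1 c2; lia.
(* An arbitrary start in [V2] shows that the alternating list ends in [V2]; restarting from that
   last vertex turns the path into a cycle. *)
have [y yV2] : exists y, y \in V2.
  by apply/set0Pn; rewrite -card_gt0 c2; lia.
have /andP[_ lV2] := alt_path _ _ y st sV1 sV2 yV2.
case altE : (alt _ _) => [|b q] //; rewrite (cycle_path b).
rewrite altE /= in lV2.
by have /andP[] := alt_path _ _ (last b q) st sV1 sV2 lV2; rewrite altE.
Qed.

End PathToCycle.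

(** * Induction over edge addition *)

Lemma hamiltonian_of_no_hole (n a : nat) (T : finType) (e : rel T)
    (V1 V2 : {set T}) :
  2 <= n -> balanced_bipartite n e V1 V2 ->
  (forall S1 S2 : {set T}, S1 \subset V1 -> S2 \subset V2 ->
    a < #|S1| -> a < #|S2| -> exists x y, [/\ x \in S1, y \in S2 & e x y]) ->
  (forall x, 2 * a < degree e x) -> hamiltonian e.
Proof.
move=> n_ge2.
(* The measure counts the non-adjacent pairs across the bipartition. Since [a] is fixed, both
   hypotheses pass to the graph with an added edge. *)
have [N] := ubnP #|[set u in setX V1 V2 | ~~ e u.1 u.2]|.
elim: N e => // N IHN e ltN Gbip no_hole deg.
have [[x y] /= /and3P[xV1 yV2 exy]|full] := pickP (fun u : T * T =>
  [&& u.1 \in V1, u.2 \in V2 & ~~ e u.1 u.2]); last first.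
  apply: (hamiltonian_complete n_ge2 Gbip) => x y xV1 yV2.
  by have := full (x, y); rewrite /= xV1 yV2 => /negbFE.
apply: (hamiltonian_of_add_edge n_ge2 Gbip no_hole deg xV1 yV2).
have [[e_sym e_irr] [VT dV sides] c1 c2] := Gbip.
have yV1 : y \notin V1 by rewrite (disjointFl dV).
apply: IHN => [|||z].
- rewrite -ltnS; apply: leq_trans ltN; rewrite ltnS; apply: proper_card.
  apply/properP; split.
    apply/subsetP=> -[u v]; rewrite !inE /= negb_or.
    by move=> /and3P[-> -> ].
  by exists (x, y); rewrite !inE /= ?xV1 ?yV2 ?exy ?eqxx ?orbT ?andbF.
- split=> //; split=> //.
  + move=> u v /=; rewrite e_sym; congr (_ || _).
    by rewrite orbC andbC [X in _ || X]andbC.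
  + move=> u /=; rewrite e_irr /=; case: eqP => [->|_] /=.
      by rewrite andbC orbb; apply: contraNF yV1 => /eqP <-.
    by rewrite andbF.
  + move=> u v /or3P[/sides //|/andP[/eqP-> /eqP->]|/andP[/eqP-> /eqP->]];
      by rewrite xV1 (negPf yV1).
- move=> S1 S2 s1 s2 a1 a2; have [u [v [uS vS euv]]] := no_hole _ _ s1 s2 a1 a2.
  by exists u, v; rewrite /= euv.
- apply: leq_trans (deg z) _; apply/subset_leq_card/subsetP=> v.
  by rewrite !inE => /= ->.
Qed.

Theorem theorem10 (n : nat) (T : finType) (e : rel T) (V1 V2 : {set T})
    (hn : 2 <= n) (hG : balanced_bipartite n e V1 V2)
    (hdeg : 2 * bipartite_indep_number e V1 V2 + 1 <= min_degree e) :
  hamiltonian e.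
Proof.
apply: (hamiltonian_of_no_hole (a := bipartite_indep_number e V1 V2) hn hG).
  move=> S1 S2 sS1 sS2 a1 a2.
  have [/existsP[x /existsP[y /and3P[xS yS exy]]]|nohole] :=
    boolP [exists x, exists y, [&& x \in S1, y \in S2 & e x y]].
    by exists x, y.
  (* With no edge between them, [S1] and [S2] would form a hole larger than the maximum. *)
  have := @card_bihole_le _ e _ _ _ _ sS1 sS2.
  rewrite geq_min leqNgt a1 leqNgt a2 /= => absurd.
  suff: false by []; apply: absurd => x y xS yS.
  apply: contra nohole => exy.
  by apply/existsP; exists x; apply/existsP; exists y; rewrite xS yS.
by move=> x; apply: leq_trans (min_degree_le e x); rewrite -addn1.
Qed.
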